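(* Let $n\ge r\ge 2$ be integers, let $p$ be a real number with $2>p\ge 1$, and let $A$ be an $n\times n$ (entrywise) nonnegative matrix with $\|A\|_{\max}\le 1$. If $A$ is $r$-partite, then $$\|A\|_p\le\frac12 n^{1/2+1/p}\sqrt{1-1/r}+(1-1/r)n.$$
   Context: $\|A\|_{\max}:=\max_{i,j}|a_{i,j}|$. For an $n\times n$ matrix $A$ with singular values $\sigma_1\ge\cdots\ge\sigma_n$ and real $p\ge1$, the Schatten $p$-norm is $\|A\|_p:=(\sigma_1^p+\cdots+\sigma_n^p)^{1/p}$. An $n\times n$ matrix $A$ is called $r$-partite if there is a partition $[n]=\{1,\dots,n\}=N_1\cup\cdots\cup N_r$ of its index set into $r$ nonempty sets such that for every $i\in\{1,\dots,r\}$ the submatrix $A[N_i,N_i]$ of all entries with both indices in $N_i$ is zero. *)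

(* Defs.v *)
From mathcomp Require Import all_boot all_order all_algebra.
From mathcomp Require Import polyrcf complex.
From mathcomp Require Import all_classical all_reals all_analysis.
Set Implicit Arguments.
Unset Strict Implicit.
Unset Printing Implicit Defensive.
Import Order.TTheory GRing.Theory Num.Theory numFieldNormedType.Exports.
Local Open Scope ring_scope.

(* Eigenvalues in R repeated according to algebraic multiplicity ([mup]);
   [rootsR] lists the distinct real roots of a polynomial. *)
Definition real_eigenvalues (R : rcfType) (n : nat) (M : 'M[R]_n) : seq R :=
  flatten [seq nseq (mup x (char_poly M)) x | x <- rootsR (char_poly M)].

Definition singular_values (R : rcfType) (n : nat) (A : 'M[R]_n) : seq R :=
  sort >=%R [seq Num.sqrt x | x <- real_eigenvalues (A^T *m A)].

Definition schatten_norm (R : realType) (n : nat) (p : R) (A : 'M[R]_n) : R :=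
  (\sum_(s <- singular_values A) s `^ p) `^ p^-1.

(* [finset.partition] already forces the blocks to be nonempty. *)
Definition partite (R : realType) (n r : nat) (A : 'M[R]_n) : Prop :=
  exists P : {set {set 'I_n}},
    [/\ finset.partition P [set: 'I_n]%SET, #|P| = r &
        forall N, N \in P -> forall i j, i \in N -> j \in N -> A i j = 0].

Lemma char_poly_similar (F : fieldType) (n : nat) (P D : 'M[F]_n) :
  P \in unitmx -> char_poly (invmx P *m D *m P) = char_poly D.
Proof.
move=> Pu; rewrite /char_poly /char_poly_mx.
have -> : 'X%:M - map_mx polyC (invmx P *m D *m P) =
  map_mx polyC (invmx P) *m ('X%:M - map_mx polyC D) *m map_mx polyC P.
  rewrite mulmxBr mulmxBl -!map_mxM /= scalar_mxC -[X in _ = X - _]mulmxA.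
  by rewrite -map_mxM /= mulVmx // map_mx1 mulmx1.
rewrite !det_mulmx mulrC mulrA -det_mulmx -map_mxM mulmxV //.
by rewrite map_mx1 det1 mul1r.
Qed.

Lemma char_poly_symmetric (R : rcfType) (n : nat) (M : 'M[R]_n) :
  M^T = M ->
  exists s : seq R, char_poly M = \prod_(x <- s) ('X - x%:P).
Proof.
move=> Msym; pose B := map_mx (real_complex R) M.
have Bh : B \is hermsymmx.
  apply/is_hermitianmxP; rewrite expr0 scale1r; apply/matrixP => i j.
  by rewrite !mxE -[in LHS]Msym mxE; apply/esym/CrealP/complex_realP; exists (M j i).
have /hermitian_normalmx/orthomx_spectralP BE := Bh.
have /mxOverP dr := hermitian_spectral_diag_real Bh.
exists [seq complex.Re (spectral_diag B 0 i) | i <- index_enum 'I_n].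
apply: (@map_poly_inj _ _ (real_complex R)).
rewrite map_char_poly -/B [in LHS]BE char_poly_similar ?spectral_unit //.
rewrite char_poly_trig ?diag_mx_is_trig // big_map rmorph_prod /=.
apply: eq_bigr => i _; rewrite map_polyXsubC mxE eqxx mulr1n /=.
by rewrite RRe_real ?dr.
Qed.

Lemma real_eigenvalues_symmetric (R : rcfType) (n : nat) (M : 'M[R]_n) :
  M^T = M -> char_poly M = \prod_(x <- real_eigenvalues M) ('X - x%:P).
Proof.
move=> /char_poly_symmetric[s sE].
rewrite [LHS]sE; apply: perm_big; apply/allP => x _ /=; apply/eqP.
have c0 : char_poly M != 0 by rewrite monic_neq0 ?char_poly_monic.
rewrite -mu_prod_XsubC -sE /real_eigenvalues count_flatten -map_comp.
rewrite sumnE big_map.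
under eq_bigr => y _ do rewrite /= count_nseq /=.
have [xr|xNr] := boolP (root (char_poly M) x).
  have xin : x \in rootsR (char_poly M).
    by have := roots_on_rootsR c0 x; rewrite xr => <-.
  rewrite (bigD1_seq x) //=; last first.
    by rewrite /rootsR; case: rootsP => // *; exact: (sorted_uniq lt_trans (@ltxx _ _)).
  rewrite eqxx mul1n big1 ?addn0 // => y /negPf yx.
  by rewrite yx.
rewrite mupNroot // big1_seq // => y /=; case: eqVneq => // -> /=.
by have := roots_on_rootsR c0 x; rewrite (negPf xNr) => <-.
Qed.

Lemma real_eigenvalues_gram_ge0 (R : rcfType) (n : nat) (A : 'M[R]_n) x :
  x \in real_eigenvalues (A^T *m A) -> 0 <= x.
Proof.
move=> xin; have Msym : (A^T *m A)^T = A^T *m A by rewrite trmx_mul trmxK.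
have : root (char_poly (A^T *m A)) x.
  by rewrite (real_eigenvalues_symmetric Msym) root_prod_XsubC.
have sq_sum m (u : 'rV[R]_m) : (u *m u^T) 0 0 = \sum_i u 0 i ^+ 2.
  by rewrite mxE; apply: eq_bigr => i _; rewrite mxE expr2.
rewrite -eigenvalue_root_char => /eigenvalueP[v vE v0].
have : (v *m A^T *m (v *m A^T)^T) 0 0 = x * (v *m v^T) 0 0.
  by rewrite trmx_mul trmxK mulmxA -[v *m _ *m A]mulmxA vE -scalemxAl mxE.
rewrite !sq_sum => E.
have vv : 0 < \sum_i v 0 i ^+ 2.
  rewrite lt_neqAle sumr_ge0 ?andbT => [|i _]; last exact: sqr_ge0.
  apply: contraNneq v0 => /esym/eqP; rewrite psumr_eq0 => [/allP h|i _].
    apply/eqP/rowP => i; rewrite mxE; apply/eqP.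
    by have := h i (mem_index_enum i); rewrite /= sqrf_eq0.
  exact: sqr_ge0.
by rewrite -(pmulr_lge0 _ vv) -E sumr_ge0 // => i _; exact: sqr_ge0.
Qed.

Lemma char_poly_gram (R : rcfType) (n : nat) (A : 'M[R]_n) :
  char_poly (A^T *m A) = \prod_(s <- singular_values A) ('X - (s ^+ 2)%:P).
Proof.
have Msym : (A^T *m A)^T = A^T *m A by rewrite trmx_mul trmxK.
rewrite [LHS](real_eigenvalues_symmetric Msym).
rewrite [RHS](perm_big _ (permEl (perm_sort _ _))) big_map /=.
rewrite big_seq [RHS]big_seq; apply: eq_bigr => x /real_eigenvalues_gram_ge0 x0.
by rewrite sqr_sqrtr.
Qed.

Lemma size_singular_values (R : rcfType) (n : nat) (A : 'M[R]_n) :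
  size (singular_values A) = n.
Proof.
have := congr1 (size : {poly R} -> nat) (char_poly_gram A).
rewrite size_char_poly.
rewrite -(big_map (fun s : R => s ^+ 2) xpredT (fun y => 'X - y%:P)).
by rewrite size_prod_XsubC size_map => -[].
Qed.

(* Main.v *)
Require Import Defs.
From mathcomp Require Import all_boot all_order all_algebra.
From mathcomp Require Import all_classical all_reals all_analysis.
From mathcomp Require Import ring lra.
Import Order.TTheory GRing.Theory Num.Theory numFieldNormedType.Exports.
Local Open Scope ring_scope.

(** Let K be the adjacency matrix of the complete r-partite graph whose classes
    are the blocks of the partition.  Since A has entries in [0, 1] and vanishes
    on the diagonal blocks, A - K / 2 has entries of modulus at most 1 / 2 and
    the same zero blocks.  The two terms of the bound come from the two summands
    of A = (A - K / 2) + K / 2.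

    The summand A - K / 2 is controlled by its Frobenius norm alone: K has at
    most (1 - 1/r) n^2 ones ([complete_multipartite_edges]), and comparing the
    p-norm with the 2-norm of n singular values costs a factor n^(1/p - 1/2).

    The summand K / 2 is controlled by a trace norm, without computing any
    eigenvalue of K.  Writing q_N for the indicator vector of a block N minus the
    constant 1/r, one has the signed sum of rank one matrices
      K = (1 - 1/r) 1 1^T - sum_N q_N q_N^T   ([complete_multipartiteE]),
    where both 1 1^T, with its coefficient, and the sum over the blocks have trace
    (1 - 1/r) n.  Half of the total is the second term of the bound.

    A triangle inequality for the Schatten norm is replaced by duality against
    one well chosen matrix ([schatten_norm_decomposition]).  If U^T A V =
    diag(s) is a singular value decomposition, put c_i = s_i^(p - 1) and pair
    every matrix M with the trace of U^T M V diag(c).  The pairing of A is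
    S = sum_i s_i^p.  The pairing of M is at most the Frobenius norm of M times
    that of diag(c) ([trace_pairing_frobenius]), and the pairing of q^T q is at
    most |q|^2 max_i c_i ([trace_pairing_rank_one]).  Since the 2-norm of c
    is at most n^(1/p - 1/2) S^(1 - 1/p) by the power mean inequality, and max_i c_i
    is at most S^(1 - 1/p), dividing by S^(1 - 1/p) gives the bound on
    S^(1/p), which is the p-norm of A. *)

(** * The Frobenius inner product *)

Section FrobeniusInnerProduct.
Variable R : rcfType.

Lemma mxtrace_mul_tr m n (M N : 'M[R]_(m, n)) :
  \tr (M *m N^T) = \sum_i \sum_j M i j * N i j.
Proof.
by apply: eq_bigr => i _; rewrite mxE; apply: eq_bigr => j _; rewrite mxE.
Qed.

Lemma frobenius_ge0 m n (M : 'M[R]_(m, n)) : 0 <= \tr (M *m M^T).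
Proof.
rewrite mxtrace_mul_tr; apply: sumr_ge0 => i _; apply: sumr_ge0 => j _.
by rewrite -expr2 sqr_ge0.
Qed.

Lemma frobenius_eq0 m n (M : 'M[R]_(m, n)) : \tr (M *m M^T) = 0 -> M = 0.
Proof.
rewrite mxtrace_mul_tr => /eqP; rewrite psumr_eq0 => [/allP h|i _]; last first.
  by apply: sumr_ge0 => j _; rewrite -expr2 sqr_ge0.
apply/matrixP => i j; rewrite mxE; apply/eqP.
have := h i (mem_index_enum i); rewrite /= psumr_eq0 => [/allP hi|k _].
  by have := hi j (mem_index_enum j); rewrite /= -expr2 sqrf_eq0.
by rewrite -expr2 sqr_ge0.
Qed.

Lemma frobenius_sym m n (M N : 'M[R]_(m, n)) : \tr (M *m N^T) = \tr (N *m M^T).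
Proof. by rewrite -mxtrace_tr trmx_mul trmxK. Qed.

(** The discriminant argument: the square norm of c M - b N equals
    c (a c - b^2), where a, b, c are the three inner products. *)
Lemma frobenius_CauchySchwarz m n (M N : 'M[R]_(m, n)) :
  \tr (M *m N^T) ^+ 2 <= \tr (M *m M^T) * \tr (N *m N^T).
Proof.
set a := \tr (M *m M^T); set b := \tr (M *m N^T); set c := \tr (N *m N^T).
have [c0|cN0] := eqVneq c 0.
  by rewrite c0 /b (frobenius_eq0 _ _ _ c0) trmx0 mulmx0 mxtrace0 expr0n mulr0.
have cgt0 : 0 < c by rewrite lt_neqAle eq_sym cN0 frobenius_ge0.
have := frobenius_ge0 _ _ (c *: M - b *: N).
rewrite [(_ - _)^T]linearB /= ![(_ *: _)^T]linearZ /=.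
rewrite mulmxBl !mulmxBr -!scalemxAl -!scalemxAr !raddfB /= !mxtraceZ.
rewrite -/a -/b -/c (frobenius_sym _ _ N M) -/b.
rewrite -[b ^+ 2 <= _]subr_ge0 -(pmulr_rge0 (a * c - b ^+ 2) cgt0).
by congr is_true; congr (0 <= _); ring.
Qed.

(** The hypothesis says that U is a partial isometry, so that U U^T is an
    orthogonal projection, and the difference of the two sides is the square norm
    of M - M U U^T. *)
Lemma bessel m n k (U : 'M[R]_(n, k)) (M : 'M[R]_(m, n)) :
  U *m U^T *m U = U -> \tr ((M *m U) *m (M *m U)^T) <= \tr (M *m M^T).
Proof.
move=> UU; rewrite -subr_ge0.
have := frobenius_ge0 _ _ (M - M *m U *m U^T).
rewrite [(_ - _)^T]linearB /= mulmxBl !mulmxBr !trmx_mul !trmxK !mulmxA.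
have -> : M *m U *m U^T *m U = M *m U by rewrite -!mulmxA (mulmxA U) UU.
by rewrite subrr subr0 raddfB.
Qed.

End FrobeniusInnerProduct.
Arguments frobenius_ge0 {R m n} M.

(** * The real spectral theorem *)

Section SpectralTheorem.
Variable R : rcfType.

(** The reflection that exchanges u and v is 1 - 2 w^T w / (w w^T) with
    w = u - v.  For unit vectors w w^T = 2 (1 - u v^T), whence the coefficient
    (1 - u v^T)^-1. *)
Lemma householder n (u v : 'rV[R]_n) : u *m u^T = 1%:M -> v *m v^T = 1%:M ->
  exists H : 'M[R]_n, [/\ H^T = H, H *m H = 1%:M & u *m H = v].
Proof.
move=> uu vv; pose w := u - v; pose t := (u *m v^T) 0 0.
have uv : u *m v^T = t%:M by rewrite [LHS]mx11_scalar.
have vu : v *m u^T = t%:M by rewrite -[v *m _]trmxK trmx_mul trmxK uv tr_scalar_mx.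
have uw : u *m w^T = (1 - t)%:M by rewrite linearB /= mulmxBr uu uv -raddfB.
have ww : w *m w^T = (2 * (1 - t))%:M.
  rewrite {1}/w mulmxBl uw linearB /= mulmxBr vv vu -!raddfB /=.
  by congr (_ %:M); ring.
have uwE : u - w = v by rewrite subKr.
have w0E : w = 0 -> u = v by move/eqP; rewrite subr_eq0 => /eqP.
clearbody w; pose k := (1 - t)^-1; pose H : 'M[R]_n := 1%:M - k *: (w^T *m w).
exists H; split.
- by rewrite /H linearB /= linearZ /= trmx1 trmx_mul trmxK.
- suff KK : (k *: (w^T *m w)) *m (k *: (w^T *m w)) = k *: (w^T *m w) *+ 2.
    by rewrite /H mulmxBl mul1mx mulmxBr mulmx1 KK mulr2n opprB addrK subrK.
  rewrite -scalemxAl -scalemxAr -mulmxA (mulmxA w) ww mul_scalar_mx.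
  rewrite -scalemxAr !scalerA scalerMnl; congr (_ *: _).
  have [t1|t1] := eqVneq (1 - t) 0; first by rewrite /k t1 invr0 !mul0r mul0rn.
  by rewrite /k; field.
- rewrite /H mulmxBr mulmx1 -scalemxAr mulmxA uw mul_scalar_mx scalerA.
  (* When u v^T = 1, the vector w has norm 0, so u = v and H is the identity. *)
  have [t1|t1] := eqVneq (1 - t) 0; last by rewrite mulVf // scale1r.
  suff w0 : w = 0 by rewrite w0 scaler0 subr0 w0E.
  by apply: frobenius_eq0; rewrite ww t1 mulr0 raddf0 mxtrace0.
Qed.

Lemma symmetric_eigenvector n (M : 'M[R]_n.+1) : M^T = M ->
  exists (a : R) (v : 'rV[R]_n.+1), v *m M = a *: v /\ v *m v^T = 1%:M.
Proof.
move=> Msym; have [[|a s] sE] := char_poly_symmetric Msym.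
  by have := size_char_poly M; rewrite sE big_nil size_poly1.
have : eigenvalue M a by rewrite eigenvalue_root_char sE root_prod_XsubC inE eqxx.
case/eigenvalueP => v vM v0; pose l := \tr (v *m v^T).
have l0 : 0 < l.
  rewrite lt_neqAle frobenius_ge0 andbT eq_sym.
  by apply: contra v0 => /eqP/frobenius_eq0 ->.
exists a, ((Num.sqrt l)^-1 *: v); split.
  by rewrite -scalemxAl vM scalerA mulrC -scalerA.
rewrite linearZ /= -scalemxAl -scalemxAr scalerA [v *m v^T]mx11_scalar.
rewrite -trace_mx11 -/l scale_scalar_mx -expr2 exprVn sqr_sqrtr ?ltW //.
by rewrite mulVf ?gt_eqF.
Qed.

(** Induction on the size: conjugating by the reflection that sends the first
    basis vector to a unit eigenvector makes that basis vector an eigenvector, and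
    by symmetry the first row and column then vanish off the diagonal. *)
Lemma symmetric_spectral n (M : 'M[R]_n) : M^T = M ->
  exists (P : 'M[R]_n) (d : 'rV[R]_n), P *m P^T = 1%:M /\ P *m M *m P^T = diag_mx d.
Proof.
elim: n M => [|n IHn] M Msym.
  by exists 1%:M, 0; split; apply/matrixP => -[].
have [a [v [vM vv]]] := symmetric_eigenvector _ _ Msym.
pose e : 'rV[R]_n.+1 := delta_mx 0 0.
have ee : e *m e^T = 1%:M.
  by rewrite trmx_delta mul_delta_mx; apply/matrixP => i j; rewrite !mxE !ord1.
have [H [Hsym HH eH]] := householder _ _ _ ee vv.
pose N : 'M[R]_(1 + n) := H *m M *m H.
have Nsym : N^T = N by rewrite /N !trmx_mul Hsym Msym mulmxA.
have eN : e *m N = a *: e.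
  by rewrite /N !mulmxA eH vM -scalemxAl -eH -mulmxA HH mulmx1.
have N0 j : N 0 j = a * (0 == j)%:R.
  have := congr1 (fun w : 'rV[R]_n.+1 => w 0 j) eN.
  by rewrite -rowE !mxE eqxx /= eq_sym.
have Ndef : H *m M *m H = N by [].
clearbody N; pose N' := drsubmx N.
have NE : N = block_mx a%:M 0 0 N'.
  rewrite -[LHS]submxK; congr block_mx; apply/matrixP => i j.
  - by rewrite !mxE !ord1 lshift0 N0 eqxx mulr1 mulr1n.
  - by rewrite !mxE !ord1 lshift0 N0 mulr0.
  by rewrite -Nsym !mxE !ord1 lshift0 N0 mulr0.
have N'sym : N'^T = N' by rewrite /N' trmx_drsub Nsym.
have [P [d [PP PN]]] := IHn N' N'sym.
pose Q : 'M[R]_(1 + n) := block_mx 1%:M 0 0 P.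
have QT : Q^T = block_mx 1%:M 0 0 P^T by rewrite tr_block_mx !trmx0 trmx1.
have QQ : Q *m Q^T = 1%:M.
  rewrite QT mulmx_block !(mulmx0, mul0mx, addr0, add0r, mulmx1) PP.
  by rewrite -scalar_mx_block.
have QN : Q *m N *m Q^T = diag_mx (row_mx a%:M d).
  rewrite QT NE !mulmx_block !(mulmx0, mul0mx, addr0, add0r, mulmx1, mul1mx) PN.
  rewrite diag_mx_row; congr block_mx.
  by apply/matrixP => i j; rewrite !mxE !ord1.
exists (Q *m H), (row_mx a%:M d); rewrite trmx_mul Hsym; split.
  by rewrite mulmxA -(mulmxA Q) HH mulmx1.
by rewrite -QN -Ndef !mulmxA.
Qed.

End SpectralTheorem.

(** * Singular value decomposition *)

Section SingularValueDecomposition.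
Variable R : rcfType.

Lemma perm_eq_prod_XsubC (s t : seq R) :
  \prod_(x <- s) ('X - x%:P) = \prod_(x <- t) ('X - x%:P) -> perm_eq s t.
Proof.
by move=> st; apply/allP => x _ /=; rewrite -!mu_prod_XsubC st.
Qed.

Lemma singular_values_ge0 n (A : 'M[R]_n) x : x \in singular_values A -> 0 <= x.
Proof. by rewrite mem_sort => /mapP[y _ ->]; exact: sqrtr_ge0. Qed.

(** Here V consists of orthonormal eigenvectors of A^T A, and the columns of U
    are the vectors A v_i / s_i.  Those with s_i = 0 are left equal to 0, so that U is
    only a partial isometry; this spares completing an orthonormal family and is
    enough for Bessel's inequality. *)
Lemma singular_value_decomposition n (A : 'M[R]_n) :
  exists (U V : 'M[R]_n) (s : 'rV[R]_n),
  [/\ V *m V^T = 1%:M, U *m U^T *m U = U, U^T *m A *m V = diag_mx s &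
      perm_eq (singular_values A) [seq s 0 i | i : 'I_n]].
Proof.
have [|P [d [PP Pd]]] := symmetric_spectral _ _ (A^T *m A).
  by rewrite trmx_mul trmxK.
have P'P : P^T *m P = 1%:M by apply: mulmx1C.
have Pu : P \in unitmx by apply: (mulmx1_unit PP).1.
have AAE : A^T *m A = invmx P *m diag_mx d *m P.
  have -> : invmx P = P^T by rewrite -[RHS](mulKmx Pu) PP mulmx1.
  by rewrite -Pd !mulmxA P'P mul1mx -!mulmxA P'P mulmx1.
have dE : perm_eq [seq s ^+ 2 | s <- singular_values A] [seq d 0 i | i : 'I_n].
  apply: perm_eq_prod_XsubC; rewrite big_map -char_poly_gram AAE.
  rewrite char_poly_similar // char_poly_trig ?diag_mx_is_trig //.
  rewrite [RHS]big_map big_enum; apply: eq_bigr => i _.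
  by rewrite mxE eqxx mulr1n.
pose s : 'rV[R]_n := \row_i Num.sqrt (d 0 i).
have ds i : d 0 i = s 0 i ^+ 2.
  have : d 0 i \in [seq d 0 i | i : 'I_n] by apply: map_f; rewrite mem_enum.
  rewrite -(perm_mem dE) => /mapP[x _ dx].
  by rewrite mxE sqr_sqrtr // dx sqr_ge0.
have sE i : s 0 i = Num.sqrt (d 0 i) by rewrite mxE.
clearbody s; pose s' : 'rV[R]_n := \row_i (s 0 i)^-1; pose W := A *m P^T.
have WW : W^T *m W = diag_mx d by rewrite trmx_mul trmxK -Pd !mulmxA.
have AP : A *m P^T = W by [].
clearbody W; exists (W *m diag_mx s'), P^T, s; split.
- by rewrite trmxK.
- rewrite trmx_mul tr_diag_mx -!mulmxA (mulmxA W^T) WW !mulmx_diag.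
  congr (_ *m diag_mx _); apply/rowP => i; rewrite !mxE ds.
  have [->|s0] := eqVneq (s 0 i) 0; first by rewrite invr0 mul0r.
  by field.
- rewrite trmx_mul tr_diag_mx -!mulmxA AP WW mulmx_diag.
  congr diag_mx; apply/rowP => i; rewrite !mxE ds.
  have [->|s0] := eqVneq (s 0 i) 0; first by rewrite invr0 mul0r.
  by field.
- have svK : map Num.sqrt [seq x ^+ 2 | x <- singular_values A] = singular_values A.
    rewrite -map_comp -[RHS]map_id; apply/eq_in_map => x /singular_values_ge0 x0 /=.
    by rewrite sqrtr_sqr ger0_norm.
  rewrite -svK /image_mem (eq_map sE) [X in perm_eq _ X](map_comp Num.sqrt).
  exact: perm_map.
Qed.

End SingularValueDecomposition.

(** * Pairing with a weighted partial isometry *)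

Section TraceDuality.
Variable R : rcfType.
Variables (n : nat) (U V : 'M[R]_n) (c : 'rV[R]_n).
Hypotheses (UU : U *m U^T *m U = U) (VV : V *m V^T *m V = V).

(** Cauchy-Schwarz against diag(c), after which Bessel's inequality removes V on
    the right and, after transposition, U on the left. *)
Lemma trace_pairing_frobenius (H : 'M[R]_n) :
  \tr (U^T *m H *m V *m diag_mx c) ^+ 2 <=
    \tr (H *m H^T) * \sum_i c 0 i ^+ 2.
Proof.
have := @frobenius_CauchySchwarz R n n (U^T *m H *m V) (diag_mx c).
rewrite tr_diag_mx => /le_trans; apply; rewrite mulmx_diag mxtrace_diag.
under eq_bigr => i _ do rewrite mxE -expr2.
apply: ler_wpM2r; first by apply: sumr_ge0 => i _; exact: sqr_ge0.
apply: (le_trans (bessel _ _ _ _ _ _ VV)).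
rewrite trmx_mul trmxK mxtrace_mulC mulmxA [X in _ <= X]mxtrace_mulC.
by have := bessel _ _ _ _ U H^T UU; rewrite trmx_mul !trmxK mulmxA.
Qed.

(** With x = q U and y = q V the trace is the sum of c_i x_i y_i, and
    |x_i y_i| <= (x_i^2 + y_i^2) / 2; by Bessel's inequality x and y are no longer
    than q. *)
Lemma trace_pairing_rank_one (q : 'rV[R]_n) (C : R) :
  (forall i, `|c 0 i| <= C) ->
  `|\tr (U^T *m (q^T *m q) *m V *m diag_mx c)| <= C * \tr (q *m q^T).
Proof.
move=> cC; pose x := q *m U; pose y := q *m V.
(* A nonzero q provides an index, hence the nonnegativity of C. *)
have [->|n0] := eqVneq q 0.
  by rewrite !(trmx0, mul0mx, mulmx0, mxtrace0) mulr0 normr0.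
have C0 : 0 <= C.
  case/rV0Pn: n0 => i _; exact: le_trans (cC i).
have Cx : C * \tr (x *m x^T) <= C * \tr (q *m q^T).
  by rewrite ler_wpM2l //; exact: bessel.
have Cy : C * \tr (y *m y^T) <= C * \tr (q *m q^T).
  by rewrite ler_wpM2l //; exact: bessel.
have -> : U^T *m (q^T *m q) *m V = x^T *m y by rewrite trmx_mul !mulmxA.
clearbody x y; have -> : \tr (x^T *m y *m diag_mx c) = \sum_i c 0 i * (x 0 i * y 0 i).
  by rewrite mul_mx_diag; apply: eq_bigr => i _; rewrite !mxE big_ord1 mxE mulrC.
have -> : C * \tr (q *m q^T) = 2^-1 * (C * \tr (q *m q^T) + C * \tr (q *m q^T)) by field.
apply: le_trans (ler_wpM2l _ (lerD Cx Cy)) => //.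
rewrite (le_trans (ler_norm_sum _ _ _)) // !mxtrace_mul_tr !big_ord1.
rewrite -mulrDr mulrCA -big_split !mulr_sumr /=; apply: ler_sum => i _.
rewrite normrM ler_pM //.
rewrite -!expr2 -[X in _ <= _ * (X + _)]real_normK ?num_real //.
rewrite -[X in _ <= _ * (_ + X)]real_normK ?num_real // normrM.
have := sqr_ge0 (`|x 0 i| - `|y 0 i|); nra.
Qed.

End TraceDuality.

(** * The power mean inequality *)

Section PowerMean.
Variable R : realType.

(** A concave power lies below its tangent at 1: this is Young's inequality for
    the product t^h * 1 with exponents 1/h and 1/(1 - h). *)
Lemma powR_le_tangent1 (t h : R) : 0 <= t -> 0 <= h <= 1 -> t `^ h <= h * t + (1 - h).
Proof.
move=> t0 /andP[]; rewrite le_eqVlt => /predU1P[<- _|h0].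
  by rewrite powRr0 mul0r add0r subr0.
rewrite le_eqVlt => /predU1P[->|h1].
  by rewrite powRr1 // mul1r subrr addr0.
have := @conjugate_powR R (t `^ h) 1 h^-1 (1 - h)^-1 (powR_ge0 _ _) ler01.
rewrite !invr_gt0 subr_gt0 !invrK -powRrM mulfV ?gt_eqF // powRr1 // powR1.
by rewrite mulr1 mul1r mulrC; apply => //; rewrite addrC subrK.
Qed.

(** Dividing all x_i by their mean m and adding up the tangent inequalities at 1:
    the linear terms sum to zero because the x_i / m have mean 1. *)
Lemma power_mean_ineq n (x : 'I_n -> R) (h : R) :
  (forall i, 0 <= x i) -> 0 < \sum_i x i -> 0 <= h <= 1 ->
  \sum_i x i `^ h <= n%:R `^ (1 - h) * (\sum_i x i) `^ h.
Proof.
move=> x0 S0 h01; set S := \sum_i x i in S0 *.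
have n0 : 0 < n%:R :> R.
  rewrite ltr0n lt0n; apply: contraTneq S0 => n0; rewrite /S.
  by rewrite big1 ?ltxx // => i _; have := ltn_ord i; rewrite {2}n0.
pose m := S / n%:R; have m0 : 0 < m by rewrite divr_gt0.
have -> : n%:R `^ (1 - h) * S `^ h = n%:R * m `^ h.
  have -> : S = m * n%:R by rewrite divfK ?gt_eqF.
  rewrite powRM ?ltW // mulrCA -powRD; last by rewrite subrK oner_eq0.
  by rewrite subrK powRr1 ?ltW // mulrC.
have -> : n%:R * m `^ h = \sum_i m `^ h * (h * (x i / m) + (1 - h)).
  rewrite -mulr_sumr big_split /= -mulr_sumr -mulr_suml -/S.
  rewrite sumr_const card_ord -[_ *+ n]mulr_natr.
  have -> : S / m = n%:R by rewrite /m invf_div mulrC divfK ?gt_eqF.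
  by ring.
apply: ler_sum => i _; have -> : x i `^ h = m `^ h * (x i / m) `^ h.
  rewrite -powRM; last 2 first.
  - exact: ltW.
  - by rewrite divr_ge0 // ltW.
  by rewrite mulrC divfK ?gt_eqF.
apply: ler_wpM2l; first exact: powR_ge0.
by apply: powR_le_tangent1; rewrite ?divr_ge0 // ltW.
Qed.

End PowerMean.

(** * Bounding a Schatten norm by a decomposition *)

(** This plays the role of the triangle inequality for the p-norm, followed by
    the comparison of the p-norm of H with its 2-norm and of the p-norm of the
    remaining sum with its trace norm.  Testing only against the matrix
    U diag(s_i^(p - 1)) V^T, which attains the p-norm of A by duality, handles the
    three steps at once. *)
Lemma schatten_norm_decomposition (R : realType) n (p : R) (A H : 'M[R]_n)
    (l : seq (R * 'rV[R]_n)) : 1 <= p -> p <= 2 ->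
  A = H + \sum_(k <- l) k.1 *: (k.2^T *m k.2) ->
  schatten_norm p A <=
    n%:R `^ (p^-1 - 2^-1) * Num.sqrt (\tr (H *m H^T)) +
    \sum_(k <- l) `|k.1| * \tr (k.2 *m k.2^T).
Proof.
move=> p1 p2 AE; have p0 : 0 < p := lt_le_trans ltr01 p1.
have [U [V [s [VV UU AUV svE]]]] := singular_value_decomposition _ _ A.
have s0 i : 0 <= s 0 i.
  apply: (singular_values_ge0 _ _ A).
  by rewrite (perm_mem svE) map_f // mem_enum.
rewrite /schatten_norm (perm_big _ svE) big_map big_enum /=.
set S := \sum_i s 0 i `^ p; set B := (X in _ <= X).
have B0 : 0 <= B.
  rewrite addr_ge0 ?mulr_ge0 ?powR_ge0 ?sqrtr_ge0 // sumr_ge0 // => k _.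
  by rewrite mulr_ge0 ?frobenius_ge0.
have : 0 <= S by apply: sumr_ge0 => i _; exact: powR_ge0.
rewrite le_eqVlt => /predU1P[<-|S0].
  by rewrite powR0 // invr_eq0 gt_eqF.
pose c : 'rV[R]_n := \row_i s 0 i `^ (p - 1).
pose q := 1 - p^-1.
have cE i : c 0 i = (s 0 i `^ p) `^ q.
  by rewrite mxE -powRrM /q mulrBr mulr1 mulfV ?gt_eqF.
have q0 : 0 <= q by rewrite subr_ge0 invf_le1.
have cC i : `|c 0 i| <= S `^ q.
  rewrite cE ger0_norm ?powR_ge0 //.
  apply: ge0_ler_powR => //; rewrite ?nnegrE ?powR_ge0 ?(ltW S0) //.
  rewrite /S (bigD1 i) //= lerDl sumr_ge0 // => j _; exact: powR_ge0.
have V' : V *m V^T *m V = V by rewrite VV mul1mx.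
have phiA : \tr (U^T *m A *m V *m diag_mx c) = S.
  rewrite AUV mulmx_diag mxtrace_diag; apply: eq_bigr => i _.
  by rewrite !mxE mulr_powRB1.
(* The exponent 2 q is at most 1 exactly because p <= 2, so the power mean
   inequality applies to the numbers s_i^p. *)
have cS : Num.sqrt (\sum_i c 0 i ^+ 2) <= n%:R `^ (p^-1 - 2^-1) * S `^ q.
  have q2 : 0 <= 2 * q <= 1.
    have pV : 2^-1 <= p^-1 by rewrite lef_pV2 ?posrE.
    by rewrite mulr_ge0 //= /q; lra.
  rewrite -[X in _ <= X]ger0_norm ?mulr_ge0 ?powR_ge0 // -sqrtr_sqr.
  apply: ler_wsqrtr; rewrite exprMn -!powR_mulrn ?powR_ge0 // -!powRrM.
  have := @power_mean_ineq R n (fun i => s 0 i `^ p) (2 * q)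
    (fun i => powR_ge0 _ _) S0 q2.
  have -> : 1 - 2 * q = (p^-1 - 2^-1) * 2%:R by rewrite /q; field; rewrite gt_eqF.
  rewrite [2 * q]mulrC; apply: le_trans.
  by apply: ler_sum => i _; rewrite cE -powR_mulrn ?powR_ge0 // -!powRrM.
have phiH : \tr (U^T *m H *m V *m diag_mx c) <=
    n%:R `^ (p^-1 - 2^-1) * Num.sqrt (\tr (H *m H^T)) * S `^ q.
  rewrite mulrAC; apply: le_trans (ler_wpM2r (sqrtr_ge0 _) cS).
  rewrite mulrC -sqrtrM ?frobenius_ge0 //; apply: le_trans (ler_norm _) _.
  by rewrite -sqrtr_sqr; apply: ler_wsqrtr; exact: trace_pairing_frobenius.
have phil : \sum_(k <- l) k.1 * \tr (U^T *m (k.2^T *m k.2) *m V *m diag_mx c) <=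
    (\sum_(k <- l) `|k.1| * \tr (k.2 *m k.2^T)) * S `^ q.
  rewrite mulr_suml; apply: ler_sum => k _; apply: le_trans (ler_norm _) _.
  rewrite normrM -mulrA ler_wpM2l // mulrC.
  exact: trace_pairing_rank_one.
have SB : S <= B * S `^ q.
  rewrite -{1}phiA AE mulmxDr !mulmxDl mxtraceD /B mulrDl lerD //.
  rewrite mulmx_sumr !mulmx_suml raddf_sum /=.
  under eq_bigr => k _ do rewrite -scalemxAr -!scalemxAl mxtraceZ.
  exact: phil.
rewrite -(ler_pM2r (powR_gt0 q S0)); apply: le_trans SB.
have pq : p^-1 + q = 1 by rewrite addrC subrK.
by rewrite -powRD pq ?oner_eq0 // powRr1 // ltW.
Qed.

(** * Complete multipartite graphs *)

Section CompleteMultipartite.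
Variables (R : realFieldType) (n : nat) (P : {set {set 'I_n}}).
Hypothesis partP : finset.partition P [set: 'I_n]%SET.

Let rho : R := #|P|%:R^-1.

(** The shift by the inverse of the number of blocks makes these vectors sum to zero over the blocks, whatever
    the sizes of the blocks. *)
Definition centred_indicator (N : {set 'I_n}) : 'rV[R]_n :=
  \row_i ((i \in N)%:R - rho).

Lemma sum_indicator (F : {set 'I_n} -> R) i :
  \sum_(N in P) (i \in N)%:R * F N = F (finset.pblock P i).
Proof.
have /and3P[/eqP covP trivP _] := partP.
have iP : i \in finset.cover P by rewrite covP inE.
rewrite (bigD1 (finset.pblock P i)) ?finset.pblock_mem //= finset.mem_pblock iP mul1r.
rewrite big1 ?addr0 // => N /andP[NP NiN].
have [iN|] := boolP (i \in N); last by rewrite mul0r.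
by rewrite (finset.def_pblock trivP NP iN) eqxx in NiN.
Qed.

Hypothesis P0 : (0 < #|P|)%N.

(** Let r be the number of blocks.  Every index lies in exactly one block, so the products of indicators sum to 1
    or 0 according to whether i and j share a block, the two cross terms sum to
    -1/r each, and the r constants 1/r^2 sum to 1/r. *)
Lemma complete_multipartiteE i j :
  1 - rho - \sum_(N in P) centred_indicator N 0 i * centred_indicator N 0 j =
  (finset.pblock P i != finset.pblock P j)%:R.
Proof.
have /and3P[/eqP covP trivP _] := partP.
have jP : j \in finset.cover P by rewrite covP inE.
have iP : i \in finset.cover P by rewrite covP inE.
have -> : (finset.pblock P i != finset.pblock P j)%:R =
    1 - (j \in finset.pblock P i)%:R :> R.
  by rewrite (finset.eq_pblock _ trivP) //; case: (_ \in _); rewrite ?subrr ?subr0.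
rewrite (eq_bigr (fun N : {set 'I_n} => (i \in N)%:R * ((j \in N)%:R - rho) +
    ((j \in N)%:R * - rho + rho * rho))); last first.
  by move=> N _; rewrite !mxE; ring.
rewrite big_split big_split /= !sum_indicator sumr_const -[rho * rho *+ _]mulr_natr /=.
have -> : rho * rho * #|P|%:R = rho.
  by rewrite /rho -mulrA mulVf ?mulr1 // pnatr_eq0 -lt0n.
by ring.
Qed.

(** The adjacency matrix has zero diagonal, hence its positive and negative
    rank one parts have the same trace. *)
Lemma sum_centred_indicator_sq :
  \sum_(N in P) \sum_i centred_indicator N 0 i ^+ 2 = (1 - rho) * n%:R.
Proof.
rewrite exchange_big /=.
under eq_bigr => i _.
  have := complete_multipartiteE i i; rewrite eqxx /= => /eqP.
  rewrite subr_eq0 => /eqP; under eq_bigr do rewrite -expr2.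
  move=> <-; over.
by rewrite sumr_const card_ord mulr_natr.
Qed.

(** Summing [complete_multipartiteE] over all i and j, the subtracted term is
    the sum over the blocks of the squares of the coordinate sums of the centred
    indicators.  Turan's bound follows by dropping these squares. *)
Lemma complete_multipartite_edges :
  \sum_(i < n) \sum_(j < n) (finset.pblock P i != finset.pblock P j)%:R <=
    (1 - rho) * n%:R ^+ 2 :> R.
Proof.
under eq_bigr => i _ do under eq_bigr => j _ do rewrite -complete_multipartiteE.
under eq_bigr => i _ do rewrite sumrB /= sumr_const card_ord exchange_big.
rewrite sumrB /= sumr_const card_ord exchange_big /=.
rewrite -mulrnA -[(1 - rho) *+ _]mulr_natr natrM -expr2 gerBl.
apply: sumr_ge0 => N _; under eq_bigr => i _ do rewrite -mulr_sumr.
by rewrite -mulr_suml -expr2 sqr_ge0.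
Qed.

End CompleteMultipartite.

(** * The bound for nonnegative partite matrices *)

Theorem theorem4p45 (R : realType) (n r : nat) (p : R) (A : 'M[R]_n) :
  (2 <= r)%N -> (r <= n)%N ->
  1 <= p -> p < 2 ->
  (forall i j, 0 <= A i j) ->
  `|A| <= 1 ->
  partite r A ->
  schatten_norm p A <=
    2^-1 * n%:R `^ (2^-1 + p^-1) * Num.sqrt (1 - r%:R^-1)
    + (1 - r%:R^-1) * n%:R.
Proof.
move=> r2 rn p1 p2 A0 A1 [P [partP cardP PA]].
have P0 : (0 < #|P|)%N by rewrite cardP ltnW.
have n0 : 0 < n%:R :> R by rewrite ltr0n (leq_trans _ rn) // ltnW.
have A1' i j : A i j <= 1.
  apply: le_trans A1; rewrite /Num.norm /= mx_normrE (le_trans (ler_norm _)) //.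
  exact: (le_bigmax _ (fun ij => `|A ij.1 ij.2|) (i, j)).
pose rho : R := r%:R^-1.
pose q N := centred_indicator R n P N.
(* These terms sum to K / 2, half of the complete multipartite adjacency matrix. *)
pose l : seq (R * 'rV[R]_n) :=
  (2^-1 * (1 - rho), const_mx 1) :: [seq (- 2^-1, q N) | N <- enum P].
pose B : 'M[R]_n := \sum_(k <- l) k.1 *: (k.2^T *m k.2).
have BE i j : B i j = 2^-1 * (finset.pblock P i != finset.pblock P j)%:R.
  rewrite -complete_multipartiteE // /B big_cons big_map big_enum /= cardP -/rho.
  rewrite mxE summxE [X in X + _]mxE [X in _ * X + _]mxE big_ord1.
  rewrite !mxE !mulr1 [in RHS]mulrBr.
  congr (_ + _); rewrite mulr_sumr -sumrN; apply: eq_bigr => N _.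
  by rewrite mxE mulNr; congr (- (_ * _)); rewrite mxE big_ord1 mxE.
have AB : A = (A - B) + B by rewrite subrK.
apply: le_trans (schatten_norm_decomposition _ _ _ _ _ _ p1 (ltW p2) AB) _.
clearbody B; apply: lerD.
  have HF : \tr ((A - B) *m (A - B)^T) <= (2^-1 * n%:R) ^+ 2 * (1 - rho).
    rewrite mxtrace_mul_tr exprMn -mulrA [_ * (1 - _)]mulrC.
    have := complete_multipartite_edges R n P partP P0; rewrite cardP -/rho.
    move=> /(ler_wpM2l (sqr_ge0 2^-1)); apply: le_trans.
    rewrite mulr_sumr; apply: ler_sum => i _.
    rewrite mulr_sumr; apply: ler_sum => j _.
    rewrite mxE [(- B) i j]mxE BE; have [ij|_] := eqVneq.
      have /and3P[/eqP covP _ _] := partP.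
      have iP k : k \in finset.cover P by rewrite covP inE.
      rewrite (PA (finset.pblock P i)) ?finset.pblock_mem //.
      + by rewrite !mulr0 subrr mul0r.
      + by rewrite finset.mem_pblock.
      by rewrite ij finset.mem_pblock.
    (* For 0 <= a <= 1 one has (a - 1/2)^2 <= 1/4. *)
    by rewrite /= !mulr1; have := A0 i j; have := A1' i j; nra.
  apply: le_trans (ler_wpM2l (powR_ge0 _ _) (ler_wsqrtr HF)) _.
  rewrite sqrtrM ?sqr_ge0 // sqrtr_sqr ger0_norm ?mulr_ge0 ?(ltW n0) //.
  rewrite -/rho mulrA ler_wpM2r ?sqrtr_ge0 // mulrCA ler_wpM2l //.
  have -> : 2^-1 + p^-1 = p^-1 - 2^-1 + 1 by lra.
  rewrite [X in _ <= X]powRD ?powRr1 ?(ltW n0) //.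
  by rewrite (gt_eqF n0) implybT.
pose u : 'rV[R]_n := const_mx 1.
have q1 : \tr (u *m u^T) = n%:R.
  rewrite mxtrace_mul_tr big_ord1 (eq_bigr (fun=> 1)) => [|i _].
    by rewrite sumr_const card_ord.
  by rewrite !mxE mulr1.
have rho1 : 0 <= 1 - rho by rewrite subr_ge0 invf_le1 ?ler1n ?ltr0n -cardP.
rewrite big_cons big_map big_enum /= -/u -/rho ger0_norm ?mulr_ge0 //.
rewrite normrN ger0_norm //.
rewrite -mulr_sumr (eq_bigr (fun N => \sum_i q N 0 i ^+ 2)) => [|N _]; last first.
  by rewrite mxtrace_mul_tr big_ord1; apply: eq_bigr => i _; rewrite expr2.
rewrite sum_centred_indicator_sq // cardP -/rho q1.
lra.
Qed.
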